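(* Let $\mathbb{K}$ be a commutative field and let $M=(a_{ij})$ be an $n\times m$ matrix over $\mathbb{K}$. Let $t$ be a fixed integer with $0<t\le \min(n,m)$, and let $s,q\in\mathbb{N}$ be chosen such that $1\le s\le \min(n-t,m-t)$ and $\min(n,m)=t+qs$. For $0\le k\le q$ let $M_k$ be the leading principal submatrix of $M$ of order $t+ks$ (so $M_0$ is the leading principal submatrix of order $t$). For $0\le k\le q-1$ let $B_k=(b^{(k)}_{ij})_{1\le i,j\le s}$ be the $s\times s$ matrix whose entry $b^{(k)}_{ij}$ is the determinant of the submatrix of $M$ with rows $1,\ldots,t+ks,\,t+ks+i$ and columns $1,\ldots,t+ks,\,t+ks+j$. Then the following identities hold for $0\le k\le q$: if $k$ is even, $$\frac{\det M_{k}}{\left[\det M_{0}\right]^{(s-1)^k}}=\frac{\displaystyle\prod_{\substack{i=1\\ i\text{ odd}}}^{k-1}\left[\det B_{i}\right]^{(s-1)^{k-1-i}}}{\displaystyle\prod_{\substack{j=0\\ j\text{ even}}}^{k-2}\left[\det B_{j}\right]^{(s-1)^{k-1-j}}}\,;$$ if $k$ is odd, $$\det M_{k}\cdot\left[\det M_{0}\right]^{(s-1)^k}=\frac{\displaystyle\prod_{\substack{i=0\\ i\text{ even}}}^{k-1}\left[\det B_{i}\right]^{(s-1)^{k-1-i}}}{\displaystyle\prod_{\substack{j=1\\ j\text{ odd}}}^{k-2}\left[\det B_{j}\right]^{(s-1)^{k-1-j}}}\,.$$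
   Context: Conventions: an empty product (one whose lower index exceeds its upper index) equals $1$, and $0^0$, considered as an empty product of zeros, equals $1$. The leading principal submatrix of order $r$ of $M$ is the submatrix formed by rows $1,\ldots,r$ and columns $1,\ldots,r$. *)

(* Defs.v *)
From mathcomp Require Import all_boot all_order all_algebra.

Set Implicit Arguments.
Unset Strict Implicit.
Unset Printing Implicit Defensive.

Import GRing.Theory.
Local Open Scope ring_scope.

(* All indices are 0-based: row (column) number r of the mathematics is r.-1  *)
(* here. Indices are plain naturals, so that the sizes t + k * s need no      *)
(* casts; the junk value 0 is used only for indices outside the matrix.       *)
Definition entry (K : fieldType) (n m : nat) (M : 'M[K]_(n, m))
    (i j : nat) : K :=
  match insub i, insub j with
  | Some i', Some j' => M i' j'
  | _, _ => 0
  end.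

Lemma entryE (K : fieldType) (n m : nat) (M : 'M[K]_(n, m))
    (i : 'I_n) (j : 'I_m) : entry M i j = M i j.
Proof. by rewrite /entry !valK. Qed.

Definition lead_mx (K : fieldType) (n m : nat) (M : 'M[K]_(n, m))
    (r : nat) : 'M[K]_r :=
  \matrix_(u < r, v < r) entry M u v.

(* The increasing enumeration of 0, .., r - 1, r + i.                         *)
Definition border_index (r i u : nat) : nat := if (u < r)%N then u else (r + i)%N.

Definition bordered_mx (K : fieldType) (n m : nat) (M : 'M[K]_(n, m))
    (r i j : nat) : 'M[K]_r.+1 :=
  \matrix_(u < r.+1, v < r.+1) entry M (border_index r i u) (border_index r j v).

Definition mxM (K : fieldType) (n m : nat) (M : 'M[K]_(n, m))
    (t s k : nat) : 'M[K]_(t + k * s) :=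
  lead_mx M (t + k * s).

Definition mxB (K : fieldType) (n m : nat) (M : 'M[K]_(n, m))
    (t s k : nat) : 'M[K]_s :=
  \matrix_(i < s, j < s) \det (bordered_mx M (t + k * s) i j).

(* Main.v *)
(** Schur complements give Sylvester's identity
    [det B_k = det M_k ^ (s - 1) * det M_(k+1)], first when the pivot block is
    regular, then in general by replacing the pivot [P] with [P + X I] over
    [K[X]] and evaluating at [X = 0]. With [x_i = det M_i ^ ((s - 1) ^ (k - i))],
    each factor [det B_i ^ ((s - 1) ^ (k - 1 - i))] is [x_i * x_(i+1)], so the
    indices pair off in either product: once denominators are cleared, both
    sides are [x_0 * ... * x_k], and vanishing minors do no harm. *)

Require Import Defs.
From mathcomp Require Import all_boot all_order all_algebra.

Set Implicit Arguments.
Unset Strict Implicit.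
Unset Printing Implicit Defensive.

Import GRing.Theory.
Local Open Scope ring_scope.

(** The blocks are free and the ring is general, so that the pivot can be perturbed over
    [{poly K}]. *)
Definition border_minors (R : comNzRingType) (r s : nat) (P : 'M[R]_r)
    (Q : 'M_(r, s)) (L : 'M_(s, r)) (S : 'M_s) : 'M_s :=
  \matrix_(i, j) \det (block_mx P (col j Q) (row i L) (S i j)%:M : 'M_(r + 1)).

(** Left multiplication by the lower triangular block matrix with rows [1, 0] and
    [- L *m \adj P, \det P] clears the block [L], because [\adj P *m P] is scalar. Using the
    adjugate instead of an inverse avoids division. *)
Lemma det_block_schur (R : comNzRingType) (r s : nat) (P : 'M[R]_r)
    (Q : 'M_(r, s)) (L : 'M_(s, r)) (S : 'M_s) :
  \det P ^+ s * \det (block_mx P Q L S) =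
  \det P * \det (\det P *: S - L *m \adj P *m Q).
Proof.
have := det_lblock (1%:M : 'M[R]_r) (- (L *m \adj P)) (\det P)%:M.
rewrite det1 mul1r det_scalar => <-; rewrite -det_mulmx mulmx_block.
rewrite !mul1mx !mul0mx !addr0 !mulNmx -(mulmxA _ _ P) mul_adj_mx.
by rewrite mul_mx_scalar !mul_scalar_mx addNr det_ublock addrC.
Qed.

Lemma det_border_minors_regular (R : idomainType) (r s : nat) (P : 'M[R]_r)
    (Q : 'M_(r, s.+1)) (L : 'M_(s.+1, r)) (S : 'M_s.+1) :
  \det P != 0 ->
  \det (border_minors P Q L S) = \det P ^+ s * \det (block_mx P Q L S).
Proof.
move=> P_neq0; apply: (mulfI P_neq0).
rewrite mulrA -exprS det_block_schur; congr (_ * \det _).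
apply/matrixP=> i j; rewrite mxE; apply: (mulfI P_neq0).
(* Each entry is the same Schur identity with a corner of size 1, whence the exponent 1. *)
rewrite -[X in X * _ = _]expr1 det_block_schur; congr (_ * _).
by rewrite det_mx11 -row_mul colE mulmxA -row_mul -colE !mxE eqxx mulr1n.
Qed.

Lemma det_border_minors (K : idomainType) (r s : nat) (P : 'M[K]_r)
    (Q : 'M_(r, s.+1)) (L : 'M_(s.+1, r)) (S : 'M_s.+1) :
  \det (border_minors P Q L S) = \det P ^+ s * \det (block_mx P Q L S).
Proof.
pose PX : 'M[{poly K}]_r := map_mx polyC P + 'X%:M.
have PX_neq0 : \det PX != 0.
  (* The determinant of [PX] is the characteristic polynomial of [- P], which is monic. *)
  have -> : PX = char_poly_mx (- P).
    by rewrite /char_poly_mx map_mxN opprK addrC.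
  exact: monic_neq0 (char_poly_monic _).
have evC a b (A : 'M[K]_(a, b)) :
    map_mx (horner_eval 0) (map_mx polyC A) = A.
  by apply/matrixP=> i j; rewrite !mxE /horner_eval hornerC.
have evP : map_mx (horner_eval 0) PX = P.
  by rewrite map_mxD evC map_scalar_mx /= /horner_eval hornerX raddf0 addr0.
have := det_border_minors_regular (map_mx polyC Q) (map_mx polyC L)
  (map_mx polyC S) PX_neq0.
move/(congr1 (horner_eval 0)).
rewrite rmorphM rmorphXn /= -!det_map_mx map_block_mx !evC evP => <-.
congr (\det _); apply/matrixP=> i j; rewrite !mxE -det_map_mx map_block_mx evP.
by rewrite map_col map_row map_scalar_mx !evC /= /horner_eval hornerC.
Qed.

Lemma det_mxB (K : fieldType) (n m : nat) (M : 'M[K]_(n, m)) (t s k : nat) :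
  (0 < s)%N ->
  \det (mxB M t s k) = \det (mxM M t s k) ^+ (s - 1) * \det (mxM M t s k.+1).
Proof.
case: s => // s _; rewrite subn1 /= /mxM.
(* The size must be a sum for the next leading submatrix to split into blocks around the pivot. *)
have -> : (t + k.+1 * s.+1 = (t + k * s.+1) + s.+1)%N.
  by rewrite mulSn addnCA addnC.
rewrite /mxB; move: (t + k * s.+1)%N => r.
pose A := lead_mx M (r + s.+1).
have ulA : ulsubmx A = lead_mx M r by apply/matrixP=> i j; rewrite !mxE.
rewrite -[lead_mx M (r + _)](submxK A) ulA -det_border_minors.
congr (\det _); apply/matrixP=> i j; rewrite !mxE /bordered_mx -addn1.
congr (\det _); apply/matrixP=> u v; rewrite /border_index.
case: (split_ordP u) => u' ->; case: (split_ordP v) => v' ->;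
  rewrite ?(block_mxEul, block_mxEur, block_mxEdl, block_mxEdr) !mxE /=.
- by rewrite !ltn_ord.
- by rewrite ltn_ord ltnNge leq_addr.
- by rewrite ltn_ord ltnNge leq_addr.
- by rewrite !ltnNge !leq_addr /= !ord1.
Qed.

Lemma prod_pairs_even (R : comNzRingType) (x : nat -> R) (h : nat) :
  \prod_(0 <= i < h.*2.-1 | ~~ odd i) (x i * x i.+1) =
  \prod_(0 <= i < h.*2) x i.
Proof.
elim: h => [|h IHh]; first by rewrite !big_geq.
rewrite doubleS /= [RHS]big_nat_recr // [in RHS]big_nat_recr //= -IHh -mulrA.
rewrite big_mkcond big_nat_recr //= odd_double /=; congr (_ * _).
(* The bounds [h.*2] and [h.*2.-1] select the same even indices, since [h.*2.-1] is odd unless [h]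
   is 0, where both ranges are empty. *)
rewrite -big_mkcond; case: h {IHh} => [|h]; first by rewrite !big_geq.
by rewrite doubleS /= big_mkcond big_nat_recr //= odd_double mulr1 -big_mkcond.
Qed.

(** Shifting the index by one gives the even case for the sequence starting at [x 1]. *)
Lemma prod_pairs_odd (R : comNzRingType) (x : nat -> R) (h : nat) :
  \prod_(1 <= i < h.*2 | odd i) (x i * x i.+1) =
  \prod_(1 <= i < h.*2.+1) x i.
Proof. by rewrite !big_add1 /= -prod_pairs_even; apply: eq_bigl => i. Qed.

Theorem theorem4 (K : fieldType) (n m : nat) (M : 'M[K]_(n, m)) (t s q : nat)
    (t_gt0 : (0 < t)%N) (t_le : (t <= minn n m)%N)
    (s_ge1 : (1 <= s)%N) (s_le : (s <= minn (n - t) (m - t))%N)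
    (min_eq : minn n m = (t + q * s)%N)
    (k : nat) (k_le : (k <= q)%N) :
  (~~ odd k ->
     let N := \prod_(1 <= i < k | odd i)
                (\det (mxB M t s i)) ^+ ((s - 1) ^ (k - 1 - i)) in
     let D := \prod_(0 <= j < k - 1 | ~~ odd j)
                (\det (mxB M t s j)) ^+ ((s - 1) ^ (k - 1 - j)) in
     let D0 := (\det (mxM M t s 0)) ^+ ((s - 1) ^ k) in
     (D0 != 0 -> D != 0 -> \det (mxM M t s k) / D0 = N / D)
     /\ \det (mxM M t s k) * D = N * D0)
  /\
  (odd k ->
     let N := \prod_(0 <= i < k | ~~ odd i)
                (\det (mxB M t s i)) ^+ ((s - 1) ^ (k - 1 - i)) in
     let D := \prod_(1 <= j < k - 1 | odd j)
                (\det (mxB M t s j)) ^+ ((s - 1) ^ (k - 1 - j)) in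
     let P0 := (\det (mxM M t s 0)) ^+ ((s - 1) ^ k) in
     (D != 0 -> \det (mxM M t s k) * P0 = N / D)
     /\ \det (mxM M t s k) * P0 * D = N).
Proof.
have cleared_div (a b c d : K) :
    b != 0 -> d != 0 -> a * d = c * b -> a / b = c / d.
  by move=> b0 d0 e; apply/eqP; rewrite eqr_div // e.
(* When [s = 1], the convention for [0 ^ 0] makes [x k] the minor itself, while [x i] is 1 for
   [i < k]. *)
pose x i := \det (mxM M t s i) ^+ ((s - 1) ^ (k - i)).
have xk : \det (mxM M t s k) = x k by rewrite /x subnn expn0 expr1.
have x0 : \det (mxM M t s 0) ^+ ((s - 1) ^ k) = x 0%N by rewrite /x subn0.
have pairE i : (i < k)%N ->
    \det (mxB M t s i) ^+ ((s - 1) ^ (k - 1 - i)) = x i * x i.+1.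
  move=> lt_ik; rewrite det_mxB // exprMn -exprM -expnS /x -subnDA add1n.
  by rewrite -subSn // subSS.
have prodE a b (Q : pred nat) : (b <= k)%N ->
    \prod_(a <= i < b | Q i) \det (mxB M t s i) ^+ ((s - 1) ^ (k - 1 - i)) =
    \prod_(a <= i < b | Q i) (x i * x i.+1).
  move=> le_bk; rewrite big_nat_cond [RHS]big_nat_cond.
  apply: eq_bigr => i /andP[/andP[_ lt_ib] _].
  exact/pairE/(leq_trans lt_ib).
split=> k_par; cbv zeta; rewrite x0 xk !prodE ?leq_subr //.
- have /= kE : k = k./2.*2 by rewrite even_halfK.
  (* The left product is [x 0 * ... * x (k - 1)], the right one [x 1 * ... * x k]. *)
  have E : x k * \prod_(0 <= i < k - 1 | ~~ odd i) (x i * x i.+1) =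
           \prod_(1 <= i < k | odd i) (x i * x i.+1) * x 0%N.
    rewrite subn1 [in RHS]kE prod_pairs_odd [in \prod_(0 <= i < _ | _) _]kE.
    rewrite prod_pairs_even -kE.
    by rewrite mulrC -big_nat_recr // big_ltn // mulrC.
  by split=> // x0_neq0 D_neq0; apply: cleared_div.
- have kE : k = k./2.*2.+1 by rewrite -[LHS]odd_double_half k_par.
  have E : x k * x 0%N * \prod_(1 <= i < k - 1 | odd i) (x i * x i.+1) =
           \prod_(0 <= i < k | ~~ odd i) (x i * x i.+1).
    have -> : (k - 1 = k./2.*2)%N by rewrite [in LHS]kE subn1.
    rewrite prod_pairs_odd -kE.
    (* As [k] is odd, [k + 1] is the double of [k./2.+1], so the even pairs below [k] cover [x 0] to
       [x k]. *)
    have := prod_pairs_even x k./2.+1; rewrite doubleS /= -kE => ->.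
    by rewrite big_nat_recr //= [in RHS]big_ltn ?odd_gt0 // -mulrA mulrC.
  by split=> // D_neq0; rewrite -E mulfK.
Qed.
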